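(* Let $A=\{a_1,\dots,a_K\}$ be a finite set of items, let $\mathcal{F}$ be an antimonotonic family of itemsets over $A$, and let $G$ be its dependency graph. Let $C\subseteq A$ be such that for every item $x\in A\setminus C$ the frontier of $x$ with respect to $C$ belongs to $\mathcal{F}$, i.e. $\mathrm{fr}(x,C)\in\mathcal{F}$. Then $C$ is a safe set.
   Context: An itemset is a subset $U\subseteq A$; its indicator $S_U:\{0,1\}^K\to\{0,1\}$ is $S_U(z)=1$ iff $z_i=1$ for all $a_i\in U$. A family $\mathcal{F}$ of itemsets is antimonotonic if every subset of a member of $\mathcal{F}$ belongs to $\mathcal{F}$. A distribution $p$ on $\{0,1\}^K$ satisfies a vector $\theta=(\theta_U)_{U\in\mathcal{F}}$ if $E_p[S_U]=\theta_U$ for all $U\in\mathcal{F}$; ''frequencies for $\mathcal{F}$'' means a vector $\theta$ satisfied by at least one distribution on $\{0,1\}^K$. For $C\subseteq A$ write $\pi_C\mathcal{F}=\{U\in\mathcal{F}:U\subseteq C\}$ and $\pi_C\theta=(\theta_U)_{U\in\pi_C\mathcal{F}}$; for a distribution $p$ on $\{0,1\}^K$, $\pi_C p$ denotes its marginal on the coordinates indexed by $C$ (a distribution on $\{0,1\}^{C}$), and $p$ is an extension of a distribution $q$ on $\{0,1\}^C$ if $\pi_C p=q$. A distribution $q$ on $\{0,1\}^C$ satisfies $\pi_C\theta$ if $E_q[S_U]=\theta_U$ for all $U\in\pi_C\mathcal{F}$. The set $C$ is $\theta$-safe if every distribution $q$ on $\{0,1\}^C$ satisfying $\pi_C\theta$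 has an extension $p$ on $\{0,1\}^K$ satisfying $\theta$; $C$ is safe if it is $\theta$-safe for all frequencies $\theta$ for $\mathcal{F}$. The dependency graph $G$ of $\mathcal{F}$ has vertex set $A$ and an undirected edge $\{a_i,a_j\}$ ($i\neq j$) iff $\{a_i,a_j\}\in\mathcal{F}$. For $C\subseteq A$ and $x\notin C$, a path from $x$ to $C$ is a path $x=v_1,v_2,\dots,v_L$ in $G$ with $v_L\in C$ and $v_1,\dots,v_{L-1}\notin C$; the frontier $\mathrm{fr}(x,C)$ is the set of last vertices $v_L$ of all paths from $x$ to $C$. *)

(* Defs.v *)
From HB Require Import structures.
From mathcomp Require Import all_boot all_order all_algebra.
From mathcomp Require Import boolp reals.
Set Implicit Arguments.
Unset Strict Implicit.
Unset Printing Implicit Defensive.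
Import Order.TTheory GRing.Theory Num.Theory.
Local Open Scope ring_scope.

(* {0,1}^I; the binary vectors over a subset C of the items A are those over
   the subtype {a : A | a \in C}. *)
Notation bvec I := {ffun I -> bool}.

Definition itemset_ind (I : finType) (U : {set I}) (z : bvec I) : bool :=
  [forall i in U, z i].

Definition distribution (R : realType) (I : finType) (p : bvec I -> R) : Prop :=
  (forall z, 0 <= p z) /\ \sum_z p z = 1.

Definition expectation (R : realType) (I : finType) (p f : bvec I -> R) : R :=
  \sum_z p z * f z.

Definition antimonotonic (A : finType) (F : {set {set A}}) : Prop :=
  forall U V : {set A}, U \in F -> V \subset U -> V \in F.

(* Frequency vectors are functions on all itemsets, of which only the values
   on the relevant family are ever used. *)
Definition satisfies (R : realType) (A : finType) (F : {set {set A}})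
    (theta : {set A} -> R) (p : bvec A -> R) : Prop :=
  forall U, U \in F -> expectation p (fun z => (itemset_ind U z)%:R) = theta U.

(* F ::&: C is the family of the members of F included in C; for such a U,
   the set val @^-1: U is U itself, seen as a subset of the subtype. *)
Definition satisfies_on (R : realType) (A : finType) (F : {set {set A}})
    (theta : {set A} -> R) (C : {set A})
    (q : bvec {a : A | a \in C} -> R) : Prop :=
  forall U, U \in F ::&: C ->
    expectation q (fun y => (itemset_ind (val @^-1: U) y)%:R) = theta U.

Definition frequencies (R : realType) (A : finType) (F : {set {set A}})
    (theta : {set A} -> R) : Prop :=
  exists p : bvec A -> R, distribution p /\ satisfies F theta p.

Definition restrict (A : finType) (C : {set A}) (z : bvec A) :
    bvec {a : A | a \in C} :=
  [ffun a => z (val a)].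

Definition marginal (R : realType) (A : finType) (C : {set A})
    (p : bvec A -> R) (y : bvec {a : A | a \in C}) : R :=
  \sum_(z | restrict C z == y) p z.

Definition extension (R : realType) (A : finType) (C : {set A})
    (q : bvec {a : A | a \in C} -> R) (p : bvec A -> R) : Prop :=
  forall y, marginal p y = q y.

Definition theta_safe (R : realType) (A : finType) (F : {set {set A}})
    (theta : {set A} -> R) (C : {set A}) : Prop :=
  forall q : bvec {a : A | a \in C} -> R,
    distribution q -> satisfies_on F theta q ->
    exists p : bvec A -> R,
      [/\ distribution p, extension q p & satisfies F theta p].

Definition safe (R : realType) (A : finType) (F : {set {set A}})
    (C : {set A}) : Prop :=
  forall theta : {set A} -> R, frequencies F theta -> theta_safe F theta C.

Definition dep_edge (A : finType) (F : {set {set A}}) : rel A :=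
  fun a b => (a != b) && ([set a; b] \in F).

(* The path is x :: s; repeated vertices are allowed, which does not change
   the set of possible last vertices. *)
Definition path_to (A : finType) (F : {set {set A}}) (C : {set A})
    (x : A) (s : seq A) : Prop :=
  [/\ path (dep_edge F) x s, last x s \in C
    & {in belast x s, forall v, v \notin C}].

Definition frontier (A : finType) (F : {set {set A}}) (x : A) (C : {set A}) :
    {set A} :=
  [set y | `[< exists2 s, path_to F C x s & last x s = y >]].

(* Main.v *)
(** Fix a distribution [p0] with frequencies [theta]. Every [U] in [F] is a
clique of the dependency graph, so if [U] meets the connected component [D] of
some [x] in [A \ C], then [U] is included in [D] together with the frontier [S]
of [x]. Since [S] and its subsets belong to [F], any [p] extending [q] has the
same marginal on [S] as [p0], by inclusion-exclusion. One may therefore replace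
the law of the coordinates in [D] by the conditional law under [p0] given those
in [S], which corrects the frequencies of all [U] meeting [D] and changes
nothing outside [D]. Doing this once for each [x] gives the extension. *)
Require Import Defs.
From mathcomp Require Import all_boot all_order all_algebra.
From mathcomp Require Import boolp reals.
From mathcomp Require Import ring.

Set Implicit Arguments.
Unset Strict Implicit.
Unset Printing Implicit Defensive.
Import Order.TTheory GRing.Theory Num.Theory.

Definition pushforward (R : realType) (T T' : finType) (g : T -> T')
    (q : T -> R) (z : T') : R :=
  (\sum_(y | g y == z) q y)%R.

Definition agree_on (A : finType) (S : {set A}) : rel (bvec A) :=
  fun z w => [forall a in S, z a == w a].

Definition component (A : finType) (F : {set {set A}}) (C : {set A}) (x : A) :
    {set A} :=
  [set y |
    connect [rel a b | [&& a \notin C, b \notin C & dep_edge F a b]] x y].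

(** An arbitrary section of [restrict C], used to get some first extension of [q]; the value outside
    [C] is immaterial. *)
Definition zero_extend (A : finType) (C : {set A})
    (y : bvec {a : A | a \in C}) : bvec A :=
  [ffun a => if insub a is Some b then y b else false].

Local Open Scope ring_scope.

Lemma sum_pushforward (R : realType) (T T' : finType) (g : T -> T')
    (q : T -> R) (f : T' -> R) :
  \sum_z pushforward g q z * f z = \sum_y q y * f (g y).
Proof.
rewrite [RHS](partition_big g predT) //=; apply: eq_bigr => z _.
by rewrite mulr_suml; apply: eq_bigr => y /eqP ->.
Qed.

Lemma pushforward_ge0 (R : realType) (T T' : finType) (g : T -> T')
    (q : T -> R) :
  (forall y, 0 <= q y) -> forall z, 0 <= pushforward g q z.
Proof. by move=> q0 z; apply: sumr_ge0. Qed.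

Lemma marginalE (R : realType) (A : finType) (C : {set A}) (p : bvec A -> R) y :
  marginal p y = expectation p (fun z => (restrict C z == y)%:R).
Proof.
rewrite /marginal /expectation big_mkcond /=; apply: eq_bigr => z _.
by case: eqP => _; rewrite ?mulr1 ?mulr0.
Qed.

(** * Marginals on a set of items, and gluing along them *)

Section Agreement.
Variables (R : realType) (A : finType).
Implicit Types (S U : {set A}) (z w : bvec A).

Lemma agree_onC S z w : agree_on S z w = agree_on S w z.
Proof. by apply: eq_forallb => a; rewrite eq_sym. Qed.

Lemma agree_onP S z w :
  reflect (forall a, a \in S -> z a = w a) (agree_on S z w).
Proof.
apply: (iffP forall_inP) => H a aS; first exact/eqP/H.
by apply/eqP/H.
Qed.

Lemma agree_on_itemset U z w :
  agree_on U z w -> itemset_ind U z = itemset_ind U w.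
Proof.
by move/agree_onP=> H; apply: eq_forallb_in => a aU; rewrite H.
Qed.

Lemma itemset_indU1 U a z : itemset_ind (a |: U) z = z a && itemset_ind U z.
Proof.
apply/forall_inP/andP => [H | [za /forall_inP H] b].
  split; first by apply: H; rewrite setU11.
  by apply/forall_inP => b bU; apply: H; rewrite setU1r.
by rewrite in_setU1 => /predU1P[-> | /H].
Qed.

(** Inclusion-exclusion: the probability of a prescribed pattern on [S] is a signed sum of
    frequencies of subsets of [S]. *)
Lemma expectation_itemset_agree (p p' : bvec A -> R) S :
  (forall U, U \subset S ->
    expectation p (fun z => (itemset_ind U z)%:R) =
    expectation p' (fun z => (itemset_ind U z)%:R)) ->
  forall z, \sum_(w | agree_on S z w) p w = \sum_(w | agree_on S z w) p' w.
Proof.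
move=> eqE z.
(* The items of [U] are required to be 1 and those of [s] to follow [z]. An item of [s] with value 1
   moves to [U]; one with value 0 gives a difference of two terms without it in [s]. *)
have gen (s : seq A) U : {subset s <= S} -> U \subset S ->
    expectation p (fun w => (itemset_ind U w && all (fun a => z a == w a) s)%:R)
    = expectation p'
        (fun w => (itemset_ind U w && all (fun a => z a == w a) s)%:R).
  elim: s U => [|a s IHs] U sS US /=.
    by under eq_fun do rewrite andbT; apply: eqE.
  have sS' : {subset s <= S} by move=> b bs; apply: sS; rewrite inE bs orbT.
  have aUS : a |: U \subset S by rewrite subUset sub1set sS ?mem_head.
  case: (z a).
    have E (d : bvec A -> R) : expectation d (fun w => (itemset_ind U w &&
        ((true == w a) && all (fun b => z b == w b) s))%:R)
        = expectation d
          (fun w => (itemset_ind (a |: U) w && all (fun b => z b == w b) s)%:R).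
      by apply: eq_bigr => w _; rewrite itemset_indU1 andbCA andbA.
    by rewrite !E; apply: IHs.
  have E (d : bvec A -> R) : expectation d (fun w => (itemset_ind U w &&
      ((false == w a) && all (fun b => z b == w b) s))%:R)
      = expectation d
          (fun w => (itemset_ind U w && all (fun b => z b == w b) s)%:R)
      - expectation d
          (fun w => (itemset_ind (a |: U) w && all (fun b => z b == w b) s)%:R).
    rewrite -sumrB; apply: eq_bigr => w _; rewrite itemset_indU1 -mulrBr.
    by case: (w a) => /=; rewrite ?andbF ?subrr ?subr0.
  by rewrite !E !IHs.
have E (d : bvec A -> R) : \sum_(w | agree_on S z w) d w = expectation d
    (fun w => (itemset_ind set0 w && all (fun a => z a == w a) (enum S))%:R).
  rewrite /expectation big_mkcond; apply: eq_bigr => w _.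
  have -> : itemset_ind set0 w by apply/forall_inP => a; rewrite inE.
  have -> : all (fun a => z a == w a) (enum S) = agree_on S z w.
    apply/allP/forall_inP => H a; first by rewrite -mem_enum; apply: H.
    by rewrite mem_enum; apply: H.
  by case: ifP; rewrite ?mulr1 ?mulr0.
by rewrite !E gen ?sub0set // => a; rewrite mem_enum.
Qed.

(** Amalgamation over a common marginal on [S]. The marginals of [r] are described by test
    functions, so that the result applies both to itemset indicators and to the indicators that
    compute [marginal]. *)
Lemma glue (p p' : bvec A -> R) (D S : {set A}) :
  distribution p -> distribution p' -> [disjoint S & D] ->
  (forall z, \sum_(w | agree_on S z w) p w = \sum_(w | agree_on S z w) p' w) ->
  exists r : bvec A -> R, [/\ distribution r,
    forall f : bvec A -> R, (forall z w, agree_on (~: D) z w -> f z = f w) ->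
      expectation r f = expectation p f &
    forall f : bvec A -> R, (forall z w, agree_on (D :|: S) z w -> f z = f w) ->
      expectation r f = expectation p' f].
Proof.
move=> [p0 p1] [p'0 p'1] SD eqpp'.
(* [r] is the law of [g (z, w)] for [z], [w] of laws [p], [p'] conditionally
   independent given that they agree on [S]. *)
pose m z := \sum_(w | agree_on S z w) p' w.
pose g (zw : bvec A * bvec A) : bvec A :=
  [ffun a => if a \in D then zw.2 a else zw.1 a].
pose c (zw : bvec A * bvec A) :=
  if agree_on S zw.1 zw.2 then p zw.1 * p' zw.2 / m zw.1 else 0.
have m0 z : 0 <= m z by apply: sumr_ge0.
have c0 zw : 0 <= c zw.
  by rewrite /c; case: ifP => // _; rewrite divr_ge0 ?mulr_ge0.
(* Where [m] vanishes, so do [p] and [p']; division by zero in [c] thus loses no mass. *)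
have mzero (d : bvec A -> R) z : (forall w, 0 <= d w) ->
    \sum_(w | agree_on S z w) d w = 0 -> d z = 0.
  move=> d0 /eqP; rewrite psumr_eq0 // => /allP /(_ z (mem_index_enum _)).
  by move/implyP => H; apply/eqP/H/agree_onP.
have EL (f : bvec A -> R) : (forall z w, agree_on (~: D) z w -> f z = f w) ->
    expectation (pushforward g c) f = expectation p f.
  move=> fD; rewrite /expectation sum_pushforward.
  rewrite -(pair_bigA _ (fun z w => c (z, w) * f (g (z, w)))) /=.
  apply: eq_bigr => z _.
  transitivity (\sum_(w | agree_on S z w) p' w * (p z / m z * f z)).
    rewrite [RHS]big_mkcond; apply: eq_bigr => w _; rewrite /c /=.
    case: ifP => [zw|]; last by rewrite mul0r.
    rewrite (fD (g (z, w)) z); first by ring.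
    by apply/agree_onP => a; rewrite inE ffunE => /negbTE ->.
  rewrite -mulr_suml -/(m z).
  have [mz|mz] := eqVneq (m z) 0; last by field.
  by rewrite mz (mzero p z) ?eqpp' //; ring.
(* Here [z] is summed out first: [m z = m w] when the two agree on [S], and the equality of
   marginals turns the total weight of such [z] under [p] into [m w]. *)
have ER (f : bvec A -> R) : (forall z w, agree_on (D :|: S) z w -> f z = f w) ->
    expectation (pushforward g c) f = expectation p' f.
  move=> fD; rewrite /expectation sum_pushforward.
  rewrite -(pair_bigA _ (fun z w => c (z, w) * f (g (z, w)))) /=.
  rewrite exchange_big /=.
  apply: eq_bigr => w _.
  transitivity (\sum_(z | agree_on S w z) p z * (p' w / m w * f w)).
    rewrite [RHS]big_mkcond; apply: eq_bigr => z _; rewrite /c /= agree_onC.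
    case: ifP => [/agree_onP zw|]; last by rewrite mul0r.
    have -> : m z = m w.
      apply: eq_bigl => u; apply/agree_onP/agree_onP => H a aS.
        by rewrite zw // H.
      by rewrite -zw // H.
    rewrite (fD (g (z, w)) w); first by ring.
    apply/agree_onP => a; rewrite inE ffunE /=; case: ifP => //= _ aS.
    by rewrite zw.
  rewrite -mulr_suml eqpp' -/(m w).
  have [mw|mw] := eqVneq (m w) 0; last by field.
  by rewrite mw (mzero p' w) //; ring.
exists (pushforward g c); split=> //; split; first exact: pushforward_ge0.
(* The total mass is the expectation of the constant 1. *)
have := EL (fun=> 1) (fun _ _ _ => erefl).
by rewrite /expectation -!mulr_suml !mulr1 => ->.
Qed.

End Agreement.

(** * Components outside [C] and their frontiers *)

Section DependencyGraph.
Variables (A : finType) (F : {set {set A}}) (C : {set A}).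

Lemma component_notin x y : x \notin C -> y \in component F C x -> y \notin C.
Proof.
rewrite inE => xC /connectP[s + ->]; elim: s x xC => //= a s IHs x xC.
by case/andP=> /and3P[_ aC _]; apply: IHs.
Qed.

Lemma frontier_sub x : frontier F x C \subset C.
Proof. by apply/subsetP => y; rewrite inE => /asboolP[s [_ + _] <-]. Qed.

(** Any other [v] in [U] is adjacent to [u]: outside [C] it stays in the component, and inside [C]
    it ends a path from [x] through [u]. *)
Lemma sub_component_frontier (U : {set A}) x u :
  antimonotonic F -> x \notin C -> U \in F -> u \in U ->
  u \in component F C x -> U \subset component F C x :|: frontier F x C.
Proof.
move=> Fanti xC UF uU uD; apply/subsetP => v vU.
have [<-|uv] := eqVneq u v; first by rewrite inE uD.
have euv : dep_edge F u v.
  rewrite /dep_edge uv (Fanti U) //.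
  by apply/subsetP => w; rewrite !inE => /orP[] /eqP ->.
have uC := component_notin xC uD.
rewrite inE; have [vC|vC] := boolP (v \in C); apply/orP; [right|left].
  move: uD; rewrite !inE => /connectP[s ps eu].
  apply/asboolP; exists (rcons s v); last by rewrite last_rcons.
  have [ps' sC] : path (dep_edge F) x s /\ {in x :: s, forall w, w \notin C}.
    elim: s x xC ps {eu} => [|a s IHs] x xC /=.
      by move=> _; split=> // w; rewrite inE => /eqP ->.
    case/andP=> /and3P[_ aC xa] /(IHs _ aC)[-> asC]; split; first by rewrite xa.
    by move=> w; rewrite inE => /predU1P[-> //|/asC].
  split; rewrite ?last_rcons //; first by rewrite rcons_path ps' -eu.
  by move=> w; rewrite belast_rcons => /sC.
move: uD; rewrite !inE => /connect_trans; apply.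
by apply: connect1; rewrite /= uC vC.
Qed.

End DependencyGraph.

(** * The initial extension of [q] *)

Section ZeroExtend.
Variables (R : realType) (A : finType) (C : {set A}).

Lemma zero_extendK : cancel (@zero_extend A C) (restrict C).
Proof. by move=> y; apply/ffunP => a; rewrite !ffunE valK. Qed.

Lemma itemset_ind_zero_extend (U : {set A}) (y : bvec {a : A | a \in C}) :
  U \subset C ->
  itemset_ind U (zero_extend y) = itemset_ind (val @^-1: U) y.
Proof.
move=> /subsetP UC; apply/forall_inP/forall_inP => H a.
  by rewrite inE => /H; rewrite ffunE valK.
move=> aU; rewrite ffunE insubT; first exact: UC.
by move=> aC; apply: H; rewrite inE.
Qed.

Lemma extension_zero_extend (q : bvec {a : A | a \in C} -> R) :
  extension q (pushforward (@zero_extend A C) q).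
Proof.
move=> y; rewrite marginalE /expectation sum_pushforward (bigD1 y) //=.
rewrite zero_extendK eqxx mulr1 big1 ?addr0 // => y' /negbTE yy'.
by rewrite zero_extendK yy' mulr0.
Qed.

End ZeroExtend.

Local Close Scope ring_scope.

Theorem theorem1 (R : realType) (A : finType) (F : {set {set A}})
  (C : {set A}) :
  antimonotonic F ->
  (forall x : A, x \notin C -> frontier F x C \in F) ->
  safe R F C.
Proof.
move=> Fanti FrF theta [p0 [p0d p0F]] q [q0 q1] qF.
(* Induction on the items treated so far, with frequencies required only inside [C] and their
   components. Each item lies in its own component, so listing all of [~: C] covers every [U]. *)
suff step (s : seq A) : {subset s <= ~: C} ->
  exists p : bvec A -> R, [/\ distribution p, extension q p &
    forall U, U \in F ->
      U \subset C :|: \bigcup_(x in s) component F C x ->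
      expectation p (fun z => (itemset_ind U z)%:R%R) = theta U].
  have [|p [pd pq pF]] := step (enum (~: C)).
    by move=> x; rewrite mem_enum.
  exists p; split=> // U UF; apply: pF => //; apply/subsetP => a _.
  rewrite inE; have [//|aC] := boolP (a \in C).
  by apply/bigcupP; exists a; rewrite ?mem_enum inE ?connect0.
elim: s => [_|x s IHs xsC].
  exists (pushforward (@zero_extend A C) q); split.
  - split; first exact: pushforward_ge0.
    have := sum_pushforward (@zero_extend A C) q (fun=> 1%R).
    by rewrite -!mulr_suml !mulr1 => ->.
  - exact: extension_zero_extend.
  move=> U UF; rewrite big_pred0 // setU0 => UC.
  rewrite /expectation sum_pushforward -qF ?inE ?UF //.
  by apply: eq_bigr => y _; rewrite itemset_ind_zero_extend.
have xC : x \notin C by have := xsC x (mem_head _ _); rewrite inE.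
have [|p [pd pq pF]] := IHs.
  by move=> y ys; apply: xsC; rewrite inE ys orbT.
pose D := component F C x; pose S := frontier F x C.
have DC a : a \in D -> a \notin C by exact: component_notin.
have SC : S \subset C by exact: frontier_sub.
have SD : [disjoint S & D].
  rewrite disjoint_subset; apply/subsetP => a /(subsetP SC) aC.
  by apply/negP => /DC; rewrite aC.
(* Subsets of [S] are in [F] and included in [C], so the induction hypothesis already gives them the
   frequencies [theta] under [p]. *)
have agreeS : forall z, (\sum_(w | agree_on S z w) p w =
    \sum_(w | agree_on S z w) p0 w)%R.
  apply: expectation_itemset_agree => U US.
  have UF : U \in F by apply: Fanti US; apply: FrF.
  rewrite p0F // pF // subsetU //; apply/orP; left; exact: subset_trans SC.
have [r [rd rp rp0]] := glue pd p0d SD agreeS.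
exists r; split=> //.
  move=> y; rewrite marginalE rp -?marginalE ?pq // => z w /agree_onP zw.
  congr (_ %:R)%R; congr (_ == _); apply/ffunP => a; rewrite !ffunE zw // inE.
  by apply/negP => /DC; rewrite (valP a).
move=> U UF Usub.
(* If [U] misses [D], its frequency is the one under [p], and the earlier components with [C]
   already cover it. Otherwise [U] lies in [D :|: S], where [r] has the law of [p0]. *)
have [UD|] := boolP [disjoint U & D].
  rewrite rp; last first.
    move=> z w /agree_onP zw; congr (nat_of_bool _)%:R%R.
    apply: agree_on_itemset.
    by apply/agree_onP => a aU; apply: zw; rewrite inE (disjointFr UD).
  apply: pF => //; apply/subsetP => a aU.
  have := subsetP Usub a aU; rewrite !inE.
  case/orP=> [-> //|/bigcupP[y + ay]]; rewrite inE.
  case/predU1P=> [yx|ys]; first by move: ay; rewrite yx -/D (disjointFr UD).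
  by apply/orP; right; apply/bigcupP; exists y.
case/pred0Pn=> u /andP[/= uU uD]; rewrite rp0 ?p0F // => z w /agree_onP zw.
congr (nat_of_bool _)%:R%R; apply: agree_on_itemset.
apply/agree_onP => a aU; apply: zw.
exact: (subsetP (sub_component_frontier Fanti xC UF uU uD)).
Qed.
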